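(* Let $k\geq 5$ and $h\geq 2$ be integers, and let $\mathcal{P}_{h}$ be the set of all $k$-polycyclic chains with $h$ $k$-polygons, i.e. the set of graphs isomorphic to $P(w)$ for some $w\in\{0,1,\dots,k-4\}^{h-2}$. Then for every $G\in\mathcal{P}_{h}$, $$Kf(G)\geq Kf(P(\underbrace{0,0,\dots,0}_{h-2})),$$ with equality if and only if $G\cong D_{h}$, where $D_h:=P(0,0,\dots,0)$ (the helicene $k$-polycyclic chain; note $P(0,\dots,0)\cong P(k-4,\dots,k-4)$).
   Context: All graphs are simple and connected. Regard each edge of a graph $G$ as a unit resistor; the resistance distance $\Omega_G(u,v)$ is the effective resistance between $u$ and $v$ in the resulting electrical network. The Kirchhoff index is $Kf(G)=\sum_{\{u,v\}\subseteq V(G)}\Omega_G(u,v)$. $k$-polycyclic chains: Let $h\geq 2$. The linear quadrilateral chain $Q_h$ has vertices $t_0,\dots,t_h,s_0,\dots,s_h$ and edges $t_{j-1}t_j$, $s_{j-1}s_j$ ($1\leq j\leq h$) and $t_js_j$ ($0\leq j\leq h$); its $i$-th square $S_i$ ($1\le i\le h$) is the 4-cycle $t_{i-1}t_is_is_{i-1}$, with top edge $t_{i-1}t_i$ and bottom edge $s_{i-1}s_i$. For $w=(w_1,\dots,w_{h-2})$ with each $w_i\in\{0,1,\dots,k-4\}$, the $k$-polycyclic chain $P(w)=P_h(w)$ is obtained from $Q_h$ by: subdividing the top edges of $S_1$ and $S_h$ with $\lceil\frac{k-4}{2}\rceil$ new vertices each and the bottom edges of $S_1$ and $S_h$ with $\lfloor\frac{k-4}{2}\rfloor$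 new vertices each; and, for $1\le i\le h-2$, subdividing the top edge of $S_{i+1}$ with $w_i$ new vertices and the bottom edge of $S_{i+1}$ with $k-4-w_i$ new vertices. Thus each square becomes a $k$-cycle (a $k$-polygon) and consecutive polygons share the edge $t_is_i$. *)

(* Defs.v *)
From mathcomp Require Import all_boot all_order all_algebra.
From mathcomp Require Import boolp classical_sets reals.
Set Implicit Arguments.
Unset Strict Implicit.
Unset Printing Implicit Defensive.
Import Order.TTheory GRing.Theory Num.Theory.
Local Open Scope ring_scope.

Record cgraph := CGraph {
  vertex :> finType;
  adj : rel vertex;
  adj_sym : symmetric adj;
  adj_irrefl : irreflexive adj;
  adj_connected : forall x y, connect adj x y }.

Definition isomorphic (G H : cgraph) : Prop :=
  exists f : G -> H, bijective f /\ forall x y, adj (f x) (f y) = adj x y.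

(* Kirchhoff's current law, with Ohm's law for unit resistors: the potential p
   drives a unit current that enters the network at u and leaves it at v. *)
Definition unit_current_potential (R : realType) (G : cgraph) (u v : G)
    (p : G -> R) : Prop :=
  forall x : G,
    \sum_(y | adj x y) (p x - p y) = (x == u)%:R - (x == v)%:R.

(* Well defined by potential_exists and resistance_eq: the default 0 is not used. *)
Definition resistance (R : realType) (G : cgraph) (u v : G) : R :=
  xget 0 (fun r => exists2 p : G -> R,
                     unit_current_potential u v p & r = p u - p v).

(* The ordering by enum_rank selects each unordered pair {u, v} exactly once. *)
Definition Kf (R : realType) (G : cgraph) : R :=
  \sum_(u : G) \sum_(v : G | (enum_rank u < enum_rank v)%N) resistance R u v.

Section Resistance.
Variables (R : realType) (G : cgraph).

Lemma harmonic_constant (q : G -> R) :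
  (forall x, \sum_(y | adj x y) (q x - q y) = 0) -> forall x y, q x = q y.
Proof.
move=> q0 x0.
have [m _ qm] := @Order.TotalTheory.arg_maxP _ _ G x0 xpredT q isT.
suff qc y : q y = q m by move=> y; rewrite !qc.
have /connectP[s] := adj_connected m y.
elim/last_ind: s y => [|s z IH] y /=; first by move=> _ ->.
rewrite rcons_path last_rcons => /andP[ps az] ->.
have := IH _ ps erefl; set w := last m s => qw.
have /eqP := q0 w; rewrite psumr_eq0; last by move=> t _; rewrite subr_ge0 qw; apply: qm.
by move=> /allP /(_ z (mem_index_enum _)); rewrite az subr_eq0 qw => /eqP.
Qed.

Lemma potential_exists (u v : G) :
  exists p : G -> R, unit_current_potential u v p.
Proof.
pose n := #|G|; pose e (i : 'I_n) : G := enum_val i.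
pose A : 'M[R]_n := \matrix_(i, j) (adj (e i) (e j))%:R.
pose d (i : 'I_n) : R := \sum_j (adj (e i) (e j))%:R.
pose L : 'M[R]_n := \matrix_(i, j) ((i == j)%:R * d j - A i j).
pose J : 'M[R]_n := const_mx 1.
have LE (p : 'rV[R]_n) j :
    (p *m L) 0 j = \sum_i (adj (e j) (e i))%:R * (p 0 j - p 0 i).
  rewrite mxE; under eq_bigr do rewrite !mxE mulrBr.
  rewrite sumrB (bigD1 j) //= eqxx mul1r big1 ?addr0; last first.
    by move=> i /negPf ->; rewrite mul0r mulr0.
  rewrite mulr_sumr -sumrB; apply: eq_bigr => i _.
  by rewrite adj_sym mulrBr [RHS]addrC ![_%:R * _]mulrC addrC.
have JE (p : 'rV[R]_n) j : (p *m J) 0 j = \sum_i p 0 i.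
  by rewrite mxE; apply: eq_bigr => i _; rewrite mxE mulr1.
have LJE (p : 'rV[R]_n) j : (p *m (L + J)) 0 j = (p *m L) 0 j + \sum_i p 0 i.
  by rewrite mulmxDr -(JE p j) [LHS]mxE.
have sumL (p : 'rV[R]_n) : \sum_j (p *m L) 0 j = 0.
  under eq_bigr do rewrite LE.
  set S := LHS; have : S = - S.
    rewrite {1}/S exchange_big -sumrN; apply: eq_bigr => i _ /=.
    rewrite -sumrN; apply: eq_bigr => j _.
    by rewrite adj_sym -mulrN opprB.
  by move/eqP; rewrite -subr_eq0 opprK -mulr2n mulrn_eq0 => /eqP.
have n0 : n%:R != 0 :> R.
  by rewrite pnatr_eq0 -lt0n; apply/card_gt0P; exists u.
have sum0 (p : 'rV[R]_n) :
    \sum_j (p *m (L + J)) 0 j = 0 -> \sum_i p 0 i = 0.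
  under eq_bigr do rewrite LJE.
  rewrite big_split /= sumL add0r sumr_const card_ord => /eqP.
  by rewrite -mulr_natr mulf_eq0 (negPf n0) orbF => /eqP.
have sume (x : G) (f : G -> R) :
    \sum_(y | adj x y) f y = \sum_i (adj x (e i))%:R * f (e i).
  rewrite big_mkcond /= (reindex e) /=; last first.
    by exists enum_rank => z _; [exact: enum_valK | exact: enum_rankK].
  by apply: eq_bigr => i _; case: ifP; rewrite ?mul1r ?mul0r.
have Lf (p : 'rV[R]_n) x :
    \sum_(y | adj x y) (p 0 (enum_rank x) - p 0 (enum_rank y))
    = (p *m L) 0 (enum_rank x).
  rewrite sume LE; apply: eq_bigr => i _.
  by rewrite /e enum_rankK enum_valK.
have U : L + J \in unitmx.
  rewrite -row_free_unit; apply: inj_row_free => p p0.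
  have s0 : \sum_i p 0 i = 0.
    by apply: sum0; rewrite p0 big1 // => j _; rewrite mxE.
  have pL j : (p *m L) 0 j = 0.
    by move/rowP: p0 => /(_ j); rewrite LJE s0 addr0 => ->; rewrite mxE.
  have pc i j : p 0 i = p 0 j.
    have := @harmonic_constant (fun x => p 0 (enum_rank x)) _ (e i) (e j).
    rewrite /e !enum_valK; apply => x; by rewrite Lf pL.
  apply/rowP => j; rewrite mxE; move: s0.
  under eq_bigr do rewrite (pc _ j).
  rewrite sumr_const card_ord => /eqP.
  by rewrite -mulr_natr mulf_eq0 (negPf n0) orbF => /eqP.
pose b : 'rV[R]_n := \row_j ((e j == u)%:R - (e j == v)%:R).
pose p := b *m invmx (L + J).
have pb : p *m (L + J) = b by rewrite mulmxKV.
have sb : \sum_j b 0 j = 0.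
  have s1 t : \sum_(j < n) (e j == t)%:R = 1 :> R.
    rewrite (bigD1 (enum_rank t)) //= /e enum_rankK eqxx big1 ?addr0 // => j.
    by rewrite -(inj_eq enum_val_inj) enum_rankK => /negPf ->.
  by under eq_bigr do rewrite mxE; rewrite sumrB !s1 subrr.
have s0 : \sum_i p 0 i = 0 by apply: sum0; rewrite pb.
exists (fun x => p 0 (enum_rank x)) => x.
rewrite Lf; move/rowP: pb => /(_ (enum_rank x)).
by rewrite LJE s0 addr0 => ->; rewrite mxE /e enum_rankK.
Qed.

Lemma resistance_eq (u v : G) (p : G -> R) :
  unit_current_potential u v p -> resistance R u v = p u - p v.
Proof.
move=> hp; apply: xget_unique; first by exists p.
move=> _ [q hq ->].
have : q u - p u = q v - p v.
  apply: (harmonic_constant (q := fun x => q x - p x)) => x.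
  transitivity (\sum_(y | adj x y) ((q x - q y) - (p x - p y))).
    by apply: eq_bigr => y _; rewrite !opprD !opprK addrACA.
  by rewrite sumrB hq hp subrr.
move/eqP; rewrite subr_eq -addrA [X in _ == X]addrC -subr_eq => /eqP ->.
by rewrite addrC.
Qed.

End Resistance.

Section Chain.
Variables (k h : nat) (w : seq nat).

(* Indices are 0-based: top_sub i and bot_sub i are the numbers of vertices
   inserted in the top and bottom edges of S_{i+1}, and w_i is nth 0 w i.-1. *)
Definition top_sub (i : nat) : nat :=
  if (i == 0)%N || (i == h.-1)%N then uphalf (k - 4) else nth 0%N w i.-1.

Definition bot_sub (i : nat) : nat :=
  if (i == 0)%N || (i == h.-1)%N then (k - 4)./2 else (k - 4 - nth 0%N w i.-1)%N.

(* After the subdivisions, the path t_0 ... t_h has vertices 0, ..., top_pos h,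
   and t_j is its vertex top_pos j; likewise for the path s_0 ... s_h. *)
Definition top_pos (j : nat) : nat := (\sum_(0 <= i < j) (top_sub i).+1)%N.
Definition bot_pos (j : nat) : nat := (\sum_(0 <= i < j) (bot_sub i).+1)%N.

Definition chain_vertex : finType :=
  ('I_(top_pos h).+1 + 'I_(bot_pos h).+1)%type.

Definition rung (a b : nat) : bool :=
  [exists j : 'I_h.+1, (a == top_pos j) && (b == bot_pos j)].

Definition chain_adj (x y : chain_vertex) : bool :=
  match x, y with
  | inl a, inl b => (a.+1 == b)%N || (b.+1 == a)%N
  | inr a, inr b => (a.+1 == b)%N || (b.+1 == a)%N
  | inl a, inr b => rung a b
  | inr b, inl a => rung a b
  end.

Lemma chain_adj_sym : symmetric chain_adj.
Proof. by move=> [a|a] [b|b] //=; rewrite orbC. Qed.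

Lemma chain_adj_irrefl : irreflexive chain_adj.
Proof. by move=> [a|a] /=; rewrite orbb gtn_eqF. Qed.

Lemma chain_adj_connected x y : connect chain_adj x y.
Proof.
have csym : connect_sym chain_adj by apply/sym_connect_sym/chain_adj_sym.
suff c0 z : connect chain_adj (inl ord0) z.
  by apply: (connect_trans _ (c0 y)); rewrite csym.
have step n (f : 'I_n.+1 -> chain_vertex) :
    (forall a b : 'I_n.+1, a.+1 = b -> chain_adj (f a) (f b)) ->
    forall a, connect chain_adj (f ord0) (f a).
  move=> fS [m lm]; elim: m lm => [|m IH] lm.
    by rewrite (_ : Ordinal lm = ord0) //; apply: val_inj.
  apply: connect_trans (IH (ltnW lm)) _; apply: connect1; exact: fS.
have r0 : chain_adj (inl ord0) (inr ord0).
  apply/existsP; exists ord0 => /=.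
  by rewrite [top_pos 0]big_geq // [bot_pos 0]big_geq.
case: z => a.
  by apply: (step _ (fun a => inl a)) => i j ij; rewrite /= ij eqxx.
apply: connect_trans (connect1 r0) _.
by apply: (step _ (fun a => inr a)) => i j ij; rewrite /= ij eqxx.
Qed.

Definition chain : cgraph :=
  CGraph chain_adj_sym chain_adj_irrefl chain_adj_connected.

End Chain.

Definition is_chain (k h : nat) (G : cgraph) : Prop :=
  exists w : (h - 2).-tuple nat,
    (forall i, tnth w i <= k - 4)%N /\ isomorphic G (chain k h w).

Definition helicene (k h : nat) : cgraph := chain k h (nseq (h - 2) 0%N).

(* Main.v *)
(* A chain is built from a single vertex by two operations on a network with two
   terminals t and s: appending a pendant edge at a terminal, whose other end
   becomes the new terminal, and joining the terminals by an edge.  Write r for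
   the resistance between t and s, and D(x) = R(x,t) - R(x,s).  The second
   operation subtracts (D(x) - D(y))^2 / (4 (r + 1)) from R(x,y).  So the order N,
   r and the sums over x of D, of D^2, of R(x,t) + R(x,s), and over x, y of R(x,y)
   obey a closed recursion.

   Let a + b = k - 2 be the numbers of top and bottom edges of a polygon,
   e = b - a and n = N - 1 - r.  The turn e enters the recursion of the sum of D^2
   only through n e^2 - 2 e (sum of D), and the sum of D is linear in the earlier
   turns.  As |e| <= k - 4, all these quantities are extremal when every turn is
   k - 4 or every turn is -(k - 4), and only then: Kf is a constant minus a
   quadratic form in the turns all of whose coefficients are positive. *)
Require Import Defs.
From mathcomp Require Import all_boot all_order all_algebra.
From mathcomp Require Import reals.
From mathcomp Require Import ring lra zify.
Set Implicit Arguments.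
Unset Strict Implicit.
Unset Printing Implicit Defensive.
Import Order.TTheory GRing.Theory Num.Theory.
Local Open Scope ring_scope.

(** * Two-terminal networks and the recursion for their resistance sums *)

Section Network.
Variables (R : realType) (V : finType).
Implicit Types (S : {set V}) (c f : V -> V -> R) (t s x y u : V).

Definition edge t s x y : R :=
  ((x == t) && (y == s))%:R + ((x == s) && (y == t))%:R.

Lemma sum_pred1 s (g : V -> R) : \sum_y (y == s)%:R * g y = g s.
Proof.
rewrite (bigD1 s) //= eqxx mul1r big1 ?addr0 // => y /negPf ->.
by rewrite mul0r.
Qed.

Lemma sum_edge t s x (g : V -> R) :
  \sum_y edge t s x y * g y = (x == t)%:R * g s + (x == s)%:R * g t.
Proof.
rewrite -(sum_pred1 s) -(sum_pred1 t g) !mulr_sumr -big_split.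
by apply: eq_bigr => y _; rewrite /edge mulrDl -!mulnb !natrM !mulrA.
Qed.

Lemma edge_neq0 t s x y :
  edge t s x y != 0 -> x = t /\ y = s \/ x = s /\ y = t.
Proof.
rewrite /edge; have [/andP[/eqP -> /eqP ->]|_] := boolP ((x == t) && (y == s)).
  by left.
have [/andP[/eqP -> /eqP ->]|_] := boolP ((x == s) && (y == t)); first by right.
by rewrite addr0 eqxx.
Qed.

(** In the Laplace identity [d] does not depend on [u], so half the difference of two columns of [f]
    is the potential of a unit current. One function [f] thus replaces a family of potentials and is
    easy to update when an edge is added. *)
Record resistance_of S c f : Prop := {
  res_supp : forall x y, c x y != 0 -> (x \in S) && (y \in S);
  res_sym : forall x y, f x y = f y x;
  res_diag : forall x, f x x = 0;
  res_laplace : exists d : V -> R, forall x u, x \in S -> u \in S ->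
    \sum_y c x y * (f y u - f x u) = 2 * (x == u)%:R + d x }.

(* sD, sQ, sS are the sums over x of D(x), D(x)^2 and R(x,t) + R(x,s); sK is the
   sum of R(x,y) over ordered pairs, that is twice the Kirchhoff index. *)
Record stats := Stats { sN : R; sr : R; sD : R; sQ : R; sS : R; sK : R }.

Definition network_stats S f t s := Stats #|S|%:R (f t s)
  (\sum_(x in S) (f x t - f x s)) (\sum_(x in S) (f x t - f x s) ^+ 2)
  (\sum_(x in S) (f x t + f x s)) (\sum_(x in S) \sum_(y in S) f x y).

(** The weights [c] are defined on all of [V] but vanish outside [S], so a chain can grow inside one
    fixed vertex type. *)
Definition network S c t s st : Prop :=
  [/\ t \in S, s \in S &
      exists2 f, resistance_of S c f & st = network_stats S f t s].

Definition flip st := Stats (sN st) (sr st) (- sD st) (sQ st) (sS st) (sK st).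

Definition extend st := Stats (sN st + 1) (sr st + 1)
  (sD st + sN st - (sr st + 1)) (sQ st + 2 * sD st + sN st + (sr st + 1) ^+ 2)
  (sS st + sN st + (sr st + 1)) (sK st + 2 * sN st + sS st + sD st).

Definition close st := Stats (sN st) (sr st / (sr st + 1)) (sD st / (sr st + 1))
  (sQ st / (sr st + 1) ^+ 2)
  (sS st - (sQ st + sN st * sr st ^+ 2) / (2 * (sr st + 1)))
  (sK st - (sN st * sQ st - sD st ^+ 2) / (2 * (sr st + 1))).

Lemma network_eq S c t s st S' c' :
  S = S' -> c =2 c' -> network S c t s st -> network S' c' t s st.
Proof.
move=> <- cc [tS sS [f [h1 h2 h3 [d h4]] ->]]; split=> //; exists f => //.
split=> // [x y|]; first by rewrite -cc; apply: h1.
by exists d => x u xS uS; rewrite -h4 //; apply: eq_bigr => y _; rewrite cc.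
Qed.

Lemma network_single t : network [set t] (fun _ _ => 0) t t (Stats 1 0 0 0 0 0).
Proof.
rewrite /network set11; split=> //; exists (fun _ _ => 0).
  split=> // [x y|]; first by rewrite eqxx.
  exists (fun=> - 2) => x u /set1P -> /set1P ->.
  by rewrite big1 ?eqxx ?mulr1 ?subrr // => y _; rewrite mul0r.
by rewrite /network_stats cards1 !big_set1 subrr addr0 expr0n.
Qed.

Lemma network_flip S c t s st : network S c t s st -> network S c s t (flip st).
Proof.
move=> [tS sS [f fP ->]]; split=> //; exists f => //.
rewrite /flip /network_stats /= (res_sym fP) -sumrN; congr Stats.
- by apply: eq_bigr => x _; rewrite opprB.
- by apply: eq_bigr => x _; rewrite -sqrrN opprB.
- by apply: eq_bigr => x _; rewrite addrC.
Qed.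

(** The new edge is a bridge: resistances inside [S] do not change, and those to [v] are those to
    [t] plus 1. The map [p] below contracts this edge. *)
Lemma network_extend S c t s st v : network S c t s st -> v \notin S ->
  network (v |: S) (fun x y => c x y + edge t v x y) v s (extend st).
Proof.
move=> [tS sS [f [f1 f2 f3 [d f4]] ->]] vS.
have Sv x : x \in S -> (x == v) = false.
  by move=> xS; apply: contraNF vS => /eqP <-.
pose p x := if x == v then t else x.
have pS x : x \in v |: S -> p x \in S.
  by rewrite /p => /setU1P[->|xS]; rewrite ?eqxx // Sv.
pose g x y := f (p x) (p y) + ((x == v) != (y == v))%:R.
have gS x y : x \in S -> y \in S -> g x y = f x y.
  by move=> xS yS; rewrite /g /p !Sv //= addr0.
have gv y : y \in S -> g v y = f t y + 1.
  by move=> yS; rewrite /g /p eqxx Sv.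
have gsym x y : g x y = g y x by rewrite /g f2 eq_sym.
have gv' x : x \in S -> g x v = f x t + 1 by move=> xS; rewrite gsym gv // f2.
have gvv : g v v = 0 by rewrite /g f3 eqxx addr0.
have c0 x y : ~~ ((x \in S) && (y \in S)) -> c x y = 0.
  by move=> H; apply/eqP/(contraNT _ H) => /f1.
split; rewrite ?inE ?eqxx ?sS ?orbT //.
exists g; last first.
  rewrite /extend /network_stats /= cardsU1 vS !big_setU1 //= !gvv !gv //.
  rewrite f2; congr Stats; rewrite ?sub0r.
  - by rewrite natrD addrC.
  - rewrite addrC; congr (_ - _).
    rewrite -sum1_card natr_sum -big_split; apply: eq_bigr => x xS.
    by rewrite gv' // gS // addrAC.
  - rewrite addrC sqrrN; congr (_ + _).
    rewrite -sum1_card natr_sum mulr_sumr -!big_split; apply: eq_bigr => x xS /=.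
    rewrite gv' // gS //; ring.
  - rewrite addrC add0r; congr (_ + _).
    rewrite -sum1_card natr_sum -big_split; apply: eq_bigr => x xS /=.
    rewrite gv' // gS //; ring.
  - have -> : \sum_(y in S) g v y = \sum_(y in S) (f y t + 1).
      by apply: eq_bigr => y yS; rewrite gv // f2.
    have -> : \sum_(x in S) \sum_(y in v |: S) g x y =
        \sum_(x in S) (f x t + 1) + \sum_(x in S) \sum_(y in S) f x y.
      rewrite -big_split; apply: eq_bigr => x xS; rewrite big_setU1 //= gv' //.
      by congr (_ + _); apply: eq_bigr => y yS; rewrite gS.
    rewrite !big_split /= sumr_const sumrN; ring.
split=> //.
- move=> x y; rewrite !inE.
  have [/andP[-> ->]|xS] := boolP ((x \in S) && (y \in S)); first by rewrite !orbT.
  by rewrite c0 // add0r => /edge_neq0[[-> ->]|[-> ->]]; rewrite eqxx tS ?orbT.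
- by move=> x; rewrite /g f3 eqxx addr0.
(* Across the bridge [g] changes by 1 in absolute value, with a sign that depends only on whether
   [u] is [v]; this gives the new values of [d] at [v] and at [t]. *)
exists (fun x => if x == v then - 1 else d x + (x == t)%:R) => x u xS uS.
under eq_bigr do rewrite mulrDl.
rewrite big_split /= (sum_edge t v x (fun y => g y u - g x u)).
case/setU1P: xS => [->|xS].
  rewrite eqxx (eq_sym v t) Sv // mul0r add0r mul1r big1; last first.
    by move=> y _; rewrite c0 ?mul0r // negb_and vS.
  case/setU1P: uS => [->|uS]; first by rewrite eqxx gvv gv' // f3 /=; ring.
  by rewrite (eq_sym v u) Sv // gv // gS //=; ring.
have -> : \sum_y c x y * (g y u - g x u) = \sum_y c x y * (f y (p u) - f x (p u)).
  apply: eq_bigr => y _; have [yS|yS] := boolP (y \in S); last first.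
    by rewrite c0 ?mul0r // negb_and yS orbT.
  by congr (_ * _); rewrite /g /p (Sv x xS) (Sv y yS); ring.
rewrite f4 ?pS // (Sv x xS) mul0r addr0.
case/setU1P: uS => [->|uS].
  rewrite /p eqxx Sv //; case: (x =P t) => [->|_]; last by rewrite /=; ring.
  by rewrite gvv gv' // f3 /=; ring.
rewrite /p (Sv u uS); case: (x =P t) => [->|_]; last by rewrite /=; ring.
by rewrite gv // gS // /=; ring.
Qed.

(** A rank-one update of the Laplacian. A unit current from x to y produces the voltage (D(y) -
    D(x)) / 2 between the terminals, and a unit resistor placed there lowers the resistance by the
    square of this voltage over r + 1. *)
Lemma network_close S c t s st : network S c t s st -> 0 <= sr st ->
  network S (fun x y => c x y + edge t s x y) t s (close st).
Proof.
move=> [tS sS [f [f1 f2 f3 [d f4]] ->]] /= r0.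
have r1 : f t s + 1 != 0 by rewrite gt_eqF // ltr_wpDl.
set r := f t s in r0 r1 *.
have [D DE] : exists D, forall x, D x = f x t - f x s by exists (fun x => f x t - f x s).
have Dt : D t = - r by rewrite DE f3 sub0r.
have Ds : D s = r by rewrite DE f3 subr0 f2.
pose g x y := f x y - (D x - D y) ^+ 2 / (4 * (r + 1)).
have Dg x : g x t - g x s = D x / (r + 1).
  rewrite /g Dt Ds -[f x t](subrK (f x s)) -DE.
  by field; exact: r1.
have Sg x : g x t + g x s = f x t + f x s - (D x ^+ 2 + r ^+ 2) / (2 * (r + 1)).
  by rewrite /g Dt Ds; field; exact: r1.
have E1 : \sum_(x in S) (f x t - f x s) = \sum_(x in S) D x.
  by apply: eq_bigr => x _; rewrite DE.
have E2 : \sum_(x in S) (f x t - f x s) ^+ 2 = \sum_(x in S) D x ^+ 2.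
  by apply: eq_bigr => x _; rewrite DE.
split=> //; exists g; last first.
  rewrite /network_stats /close /= -/r E1 E2; congr Stats.
  - by rewrite /g Dt Ds -/r; field; exact: r1.
  - by rewrite mulr_suml; apply: eq_bigr => x _; rewrite Dg.
  - rewrite mulr_suml; apply: eq_bigr => x _; rewrite Dg.
    by rewrite expr_div_n.
  - rewrite -sum1_card natr_sum [in X in _ + X]mulr_suml -big_split /=.
    rewrite mulr_suml -sumrB; apply: eq_bigr => x _.
    by rewrite Sg mul1r.
  (* Over ordered pairs the squares (D(x) - D(y))^2 sum to twice N Q - D^2, where D and Q are the
     sums of D(x) and D(x)^2. *)
  - transitivity (\sum_(x in S) \sum_(y in S) f x y
      - (\sum_(x in S) \sum_(y in S) (D x - D y) ^+ 2) / (4 * (r + 1))).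
      congr (_ - _); have -> : \sum_(x in S) \sum_(y in S) (D x - D y) ^+ 2 =
          2 * (#|S|%:R * \sum_(x in S) D x ^+ 2 - (\sum_(x in S) D x) ^+ 2).
        transitivity (\sum_(x in S) (#|S|%:R * D x ^+ 2 +
           \sum_(y in S) D y ^+ 2 - 2 * D x * \sum_(y in S) D y)).
          apply: eq_bigr => x _.
          transitivity (\sum_(y in S) (D x ^+ 2 + D y ^+ 2 - 2 * D x * D y)).
            by apply: eq_bigr => y _; ring.
          by rewrite !big_split /= sumr_const sumrN -mulr_sumr -[_ *+ #|_|]mulr_natl.
        rewrite !big_split /= sumrN -mulr_sumr sumr_const -mulr_suml -mulr_sumr.
        by rewrite -[_ *+ #|_|]mulr_natl; ring.
      by field; exact: r1.
    rewrite mulr_suml -sumrB; apply: eq_bigr => x _.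
    by rewrite mulr_suml -sumrB.
split=> //.
- move=> x y; have [/f1 //|/negPn/eqP ->] := boolP (c x y != 0).
  by rewrite add0r => /edge_neq0[[-> ->]|[-> ->]]; rewrite tS sS.
- by move=> x y; rewrite /g f2 -[in LHS]sqrrN opprB.
- by move=> x; rewrite /g f3 subrr expr0n mul0r subr0.
(* Expanding the squares in [g], the part without D(u) goes into the new [d]. The part linear in
   D(u) is a multiple of the Laplacian of D, which lives at the terminals by [DL], and there the new
   edge cancels it. *)
exists (fun x => d x - (\sum_y c x y * (D y ^+ 2 - D x ^+ 2)) / (4 * (r + 1))).
move=> x u xS uS; under eq_bigr do rewrite mulrDl.
rewrite big_split /= (sum_edge t s x (fun y => g y u - g x u)).
have DL : \sum_y c x y * (D y - D x) = 2 * (x == t)%:R - 2 * (x == s)%:R.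
  transitivity (\sum_y c x y * (f y t - f x t) - \sum_y c x y * (f y s - f x s)).
    by rewrite -sumrB; apply: eq_bigr => y _; rewrite !DE; ring.
  by rewrite !f4 //; ring.
have -> : \sum_y c x y * (g y u - g x u) = \sum_y c x y * (f y u - f x u)
   - (\sum_y c x y * (D y ^+ 2 - D x ^+ 2)) / (4 * (r + 1))
   + D u * (\sum_y c x y * (D y - D x)) / (2 * (r + 1)).
  rewrite mulr_sumr !mulr_suml -sumrB -big_split; apply: eq_bigr => y _ /=.
  by rewrite /g; field; exact: r1.
rewrite f4 // DL.
have gD : g s u - g t u = - (D u / (r + 1)).
  by rewrite -Dg opprB /g !(f2 _ u) -![(D u - _) ^+ 2]sqrrN !opprB.
case: (x =P t) => [->|_]; case: (_ =P s) => [E|_].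
- by rewrite E; field; exact: r1.
- by rewrite mul1r mul0r gD /=; field; exact: r1.
- rewrite mul0r mul1r E -[g t u - _]opprB gD /=; by field; exact: r1.
- by rewrite /=; field; exact: r1.
Qed.

End Network.

(** * Closed form of the recursion for one polygon *)

Section Ring.
Variable R : realType.
Implicit Types (st : stats R) (N r m : R).

(** It is invariant under [extend], and it is the amount by which each [extend] raises [sD]. *)
Definition excess st : R := sN st - 1 - sr st.

(** Its difference from r to r + 1 is (r + 1)(r + 2), the part of the increment of [sQ] under
    [extend] that remains after 2 [sD] and the excess are removed. *)
Definition cubic (x : R) : R := x * (x + 1) * (x + 2) / 3.

Lemma iter_extend a st : iter a (@extend R) st =
  let x := a%:R in let n := excess st in
  Stats (sN st + x) (sr st + x) (sD st + n * x)
    (sQ st + 2 * x * sD st + n * x ^+ 2 + cubic (sr st + x) - cubic (sr st))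
    (sS st + x * (sN st + sr st + x))
    (sK st + 2 * sN st * x + x * (x - 1) + x * sS st + x * sD st
     + (sN st + sr st) * x * (x - 1) / 2 + (x - 1) * x * (2 * x - 1) / 6
     + n * x * (x - 1) / 2).
Proof.
elim: a => [|a IH] /=.
  by case: st => *; rewrite /cubic /=; congr Stats; field.
rewrite IH /extend /excess /cubic /= -?natr1; case: st {IH} => N r D Q S K /=.
by congr Stats; field.
Qed.

Definition ring_step a b st : stats R :=
  flip (close (iter b (@extend R) (flip (iter a (@extend R) st)))).

(** The value of [sQ] once both paths of a polygon are attached but the closing rung is not; m and e
    stand for a + b and b - a. *)
Definition Qpre st m e : R :=
  sQ st - 2 * e * sD st + excess st * e ^+ 2 + cubic (sr st + m) - cubic (sr st).

Definition Kconst N r m : R :=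
  2 * N * m + m * (m - 1) + (N + r) * m * (m - 1) / 2
  + (m - 1) * m * (2 * m - 1) / 6 - (N - 1 - r) * m / 2
  - (N + m) * (cubic (r + m) - cubic r) / (2 * (r + m + 1)).

(** Only m = a + b and the turn e = b - a matter, and e is absent from [sK]: its contributions from
    the two paths and from the closing cancel. A turn therefore affects [sK] only through later
    polygons. *)
Lemma ring_stepE a b st : 0 <= sr st -> ring_step a b st =
  let m := (a + b)%:R in let e := b%:R - a%:R in let W := sr st + m in
  Stats (sN st + m) (W / (W + 1)) ((sD st - excess st * e) / (W + 1))
   (Qpre st m e / (W + 1) ^+ 2)
   (sS st + m * (sN st + sr st + m)
     - (Qpre st m e + (sN st + m) * W ^+ 2) / (2 * (W + 1)))
   (sK st + m * sS st + Kconst (sN st) (sr st) m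
     - ((sN st + m) * sQ st - sD st ^+ 2) / (2 * (W + 1))).
Proof.
case: st => N r D Q S K /= r0; rewrite /ring_step iter_extend /flip /=.
rewrite iter_extend /close /Qpre /Kconst /excess natrD /= (addrA r).
have : r + a%:R + b%:R + 1 != 0 by rewrite gt_eqF // ltr_wpDl // !addr_ge0.
move: (a%:R) (b%:R) => x y W0.
move: (cubic _) (cubic (r + x)) (cubic (r + x + y)) => c0 c1 c2.
by congr Stats; field.
Qed.

End Ring.

(** * The Kirchhoff index as a sum over ordered pairs *)

Section Kirchhoff.
Variables (R : realType).

Lemma resistance_sym (G : cgraph) (u v : G) : resistance R u v = resistance R v u.
Proof.
have [p hp] := potential_exists R u v.
rewrite (resistance_eq hp) (@resistance_eq _ _ v u (fun x => - p x)) ?opprK 1?addrC //.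
move=> x; rewrite -opprB -hp -sumrN; apply: eq_bigr => y _.
by rewrite opprK opprB addrC.
Qed.

Lemma resistance_diag (G : cgraph) (u : G) : resistance R u u = 0.
Proof. by have [p hp] := potential_exists R u u; rewrite (resistance_eq hp) subrr. Qed.

Lemma Kf_double (G : cgraph) :
  2 * Kf R G = \sum_(u : G) \sum_(v : G) resistance R u v.
Proof.
pose lt (u v : G) := (enum_rank u < enum_rank v)%N.
have -> : \sum_(u : G) \sum_(v : G) resistance R u v =
    \sum_(u : G) \sum_(v | lt u v) resistance R u v +
    \sum_(u : G) \sum_(v | lt v u) resistance R u v.
  rewrite -big_split; apply: eq_bigr => u _ /=.
  rewrite (bigID (lt u)) /=; congr (_ + _).
  rewrite (bigID (fun v => lt v u)) /= [X in _ + X]big1 ?addr0.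
    by apply: eq_bigl => v; rewrite /lt -leqNgt andb_idl // => /ltnW.
  move=> v; rewrite /lt -!leqNgt => H; have -> : u = v; last exact: resistance_diag.
  by apply/enum_rank_inj/val_inj/anti_leq; rewrite andbC.
rewrite [X in _ + X](exchange_big_dep xpredT) //= mulr_natl mulr2n /Kf; congr (_ + _).
by apply: eq_bigr => u _; apply: eq_bigr => v _; rewrite resistance_sym.
Qed.

Lemma Kf_isomorphic (G H : cgraph) : isomorphic G H -> Kf R G = Kf R H.
Proof.
move=> [f [fb fa]].
have E u v : resistance R u v = resistance R (f u) (f v).
  have [p hp] := potential_exists R (f u) (f v).
  rewrite (resistance_eq hp); apply: (resistance_eq (p := p \o f)) => x.
  rewrite -!(inj_eq (bij_inj fb)) -hp (reindex f) /=; last exact: onW_bij.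
  by apply: eq_bigl => y; rewrite fa.
(* An isomorphism need not respect [enum_rank]; the sum over ordered pairs does not refer to it. *)
suff : 2 * Kf R G = 2 * Kf R H by apply: mulfI; rewrite pnatr_eq0.
rewrite !Kf_double [RHS](reindex f) /=; last exact: onW_bij.
apply: eq_bigr => u _; rewrite [RHS](reindex f) /=; last exact: onW_bij.
by apply: eq_bigr => v _.
Qed.

Lemma Kf_network (G : cgraph) (t s : G) st :
  network [set: G] (fun x y => (adj x y)%:R : R) t s st -> 2 * Kf R G = sK st.
Proof.
move=> [_ _ [f [_ f2 f3 [d f4]] ->]]; rewrite Kf_double /=.
rewrite [RHS]big_mkcond; apply: eq_bigr => u _; rewrite inE.
rewrite [RHS]big_mkcond; apply: eq_bigr => v _; rewrite inE.
(* Subtracting the columns of v and u removes [d] and leaves unit sources at u and v. *)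
rewrite (@resistance_eq _ _ u v (fun x => (f x v - f x u) / 2)).
  by rewrite !f3 (f2 v u); field.
move=> x; have [xu xv] := (f4 x u (in_setT _) (in_setT _), f4 x v (in_setT _) (in_setT _)).
transitivity ((\sum_y (adj x y)%:R * (f y u - f x u) -
   \sum_y (adj x y)%:R * (f y v - f x v)) / 2); last by rewrite xu xv; field.
rewrite -sumrB mulr_suml big_mkcond; apply: eq_bigr => y _.
by case: (adj x y) => /=; field.
Qed.

End Kirchhoff.

(** * Building a chain vertex by vertex as a network *)

Section ChainNetwork.
Variables (R : realType) (k h : nat) (w : seq nat).
Local Notation V := (chain_vertex k h w).
Local Notation tp := (top_pos k h w).
Local Notation bp := (bot_pos k h w).

Let T p : V := inl (inord p).
Let B q : V := inr (inord q).

(** Partial chains are cut out of the vertex type of the finished chain: the paths up to positions p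
    and q, and the first J rungs. *)
Definition stage_set p q : {set V} :=
  [set x : V | match x with inl a => (a <= p)%N | inr b => (b <= q)%N end].

Definition stage_rung J (a b : nat) := has (fun i => (a == tp i) && (b == bp i)) (iota 0 J).

Definition stage_adj p q J (x y : V) : bool :=
  match x, y with
  | inl a, inl b => [&& (a.+1 == b)%N || (b.+1 == a)%N, (a <= p)%N & (b <= p)%N]
  | inr a, inr b => [&& (a.+1 == b)%N || (b.+1 == a)%N, (a <= q)%N & (b <= q)%N]
  | inl a, inr b => stage_rung J a b
  | inr b, inl a => stage_rung J a b
  end.

Definition stage p q J t s st : Prop :=
  network (stage_set p q) (fun x y => (stage_adj p q J x y)%:R : R) t s st.

Lemma eqT a p : (p <= tp h)%N -> (inl a == T p :> V) = (a == p :> nat).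
Proof. by move=> hp; rewrite /T /eq_op /= -val_eqE /= inordK. Qed.

Lemma eqB a p : (p <= bp h)%N -> (inr a == B p :> V) = (a == p :> nat).
Proof. by move=> hp; rewrite /B /eq_op /= -val_eqE /= inordK. Qed.

Lemma top_pos_lt i j : (i < j)%N -> (tp i < tp j)%N.
Proof.
elim: j => // j IH; rewrite ltnS leq_eqVlt.
have jS : (tp j < tp j.+1)%N.
  by rewrite /top_pos big_nat_recr //= addnS ltnS leq_addr.
by case/orP => [/eqP ->|/IH /ltn_trans]; last apply.
Qed.

Lemma bot_pos_lt i j : (i < j)%N -> (bp i < bp j)%N.
Proof.
elim: j => // j IH; rewrite ltnS leq_eqVlt.
have jS : (bp j < bp j.+1)%N.
  by rewrite /bot_pos big_nat_recr //= addnS ltnS leq_addr.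
by case/orP => [/eqP ->|/IH /ltn_trans]; last apply.
Qed.

Lemma top_pos_le i j : (i <= j)%N -> (tp i <= tp j)%N.
Proof. by rewrite leq_eqVlt => /orP[/eqP ->|/top_pos_lt/ltnW]. Qed.

Lemma bot_pos_le i j : (i <= j)%N -> (bp i <= bp j)%N.
Proof. by rewrite leq_eqVlt => /orP[/eqP ->|/bot_pos_lt/ltnW]. Qed.

Lemma stage_extend_top p q J s st : (p < tp h)%N ->
  stage p q J (T p) s st -> stage p.+1 q J (T p.+1) s (extend st).
Proof.
move=> hp H; apply: network_eq (network_extend H (v := T p.+1) _).
- by apply/setP => -[a|b]; rewrite !inE ?eqT //=; lia.
- move=> [a|a] [b|b]; rewrite /edge ?eqT ?(ltnW hp) //= -?natrD ?andbF ?addn0 ?addr0 //.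
  by congr (_%:R); lia.
- by rewrite inE /= inordK //; lia.
Qed.

Lemma stage_extend_bot p q J s st : (q < bp h)%N ->
  stage p q J (B q) s st -> stage p q.+1 J (B q.+1) s (extend st).
Proof.
move=> hp H; apply: network_eq (network_extend H (v := B q.+1) _).
- by apply/setP => -[a|b]; rewrite !inE ?eqB //=; lia.
- move=> [a|a] [b|b]; rewrite /edge ?eqB ?(ltnW hp) //= -?natrD ?andbF ?addn0 ?addr0 //.
  by congr (_%:R); lia.
- by rewrite inE /= inordK //; lia.
Qed.

(** It is an equality of numbers because weights add when an edge is joined; the new rung is not an
    earlier one, since [top_pos] is strictly increasing. *)
Lemma stage_rungS J a b :
  (stage_rung J.+1 a b : nat) = (stage_rung J a b + ((a == tp J) && (b == bp J)))%N.
Proof.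
rewrite /stage_rung -(addn1 J) iotaD has_cat /= orbF add0n.
case: hasP => [[i]|_] /=; last by [].
rewrite mem_iota add0n => /top_pos_lt H /andP[/eqP -> _].
by rewrite (ltn_eqF H).
Qed.

Lemma stage_close J st : (J <= h)%N -> 0 <= sr st ->
  stage (tp J) (bp J) J (B (bp J)) (T (tp J)) st ->
  stage (tp J) (bp J) J.+1 (B (bp J)) (T (tp J)) (close st).
Proof.
move=> hJ r0 H; apply: network_eq (network_close H r0) => //.
have [hT hB] := (top_pos_le hJ, bot_pos_le hJ).
move=> [a|a] [b|b]; rewrite /edge ?eqT ?eqB //= -?natrD ?andbF ?addn0 ?addr0 //;
  by congr (_%:R); rewrite ?stage_rungS; lia.
Qed.

Definition rung_stats : stats R := flip (extend (Stats 1 0 0 0 0 0)).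

Fixpoint chain_stats j : stats R :=
  if j is j'.+1 then
    ring_step (top_sub k h w j').+1 (bot_sub k h w j').+1 (chain_stats j')
  else rung_stats.

Lemma chain_statsS j : chain_stats j.+1 =
  ring_step (top_sub k h w j).+1 (bot_sub k h w j).+1 (chain_stats j).
Proof. by []. Qed.

Lemma stage_chain j : (j <= h)%N -> 0 <= sr (chain_stats j) /\
  stage (tp j) (bp j) j.+1 (T (tp j)) (B (bp j)) (chain_stats j).
Proof.
elim: j => [_|j IH jh].
  split; first by rewrite /= add0r ler01.
  have t0 : tp 0 = 0%N by rewrite /top_pos big_geq.
  have b0 : bp 0 = 0%N by rewrite /bot_pos big_geq.
  apply/network_flip.
  (* The first rung is a pendant edge at t_0; all later rungs close a polygon. *)
  apply: network_eq (network_extend (network_single R (T (tp 0))) (v := B (bp 0)) _).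
  - apply/setP => -[a|b]; rewrite !inE ?eqT ?eqB ?t0 ?b0 //= ?leqn0 //.
    by rewrite orbF.
  - move=> [a|a] [b|b]; rewrite /edge ?eqT ?eqB ?t0 ?b0 //= ?stage_rungS ?andbF ?t0 ?b0 //=.
    + by rewrite !addr0; apply/esym/eqP; rewrite pnatr_eq0; lia.
    + by rewrite add0r addr0.
    + by rewrite !add0r andbC.
    + by rewrite !addr0; apply/esym/eqP; rewrite pnatr_eq0; lia.
  - by rewrite inE.
have [r0 H] := IH (ltnW jh).
set a := (top_sub k h w j).+1; set b := (bot_sub k h w j).+1.
have tS : tp j.+1 = (tp j + a)%N by rewrite /top_pos big_nat_recr.
have bS : bp j.+1 = (bp j + b)%N by rewrite /bot_pos big_nat_recr.
have [tle ble] := (top_pos_le jh, bot_pos_le jh).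
split.
  rewrite chain_statsS ring_stepE //=; apply: divr_ge0; rewrite ?addr_ge0 //.
rewrite chain_statsS -/a -/b.
(* The top path of the polygon is laid first, then the bottom path with the terminals exchanged,
   then the rung. *)
have Ha i : (i <= a)%N -> stage (tp j + i) (bp j) j.+1 (T (tp j + i)) (B (bp j))
    (iter i (@extend R) (chain_stats j)).
  elim: i => [|i IHi] ia; first by rewrite addn0.
  by rewrite addnS; apply: stage_extend_top (IHi (ltnW ia)); lia.
have Hb i : (i <= b)%N -> stage (tp j.+1) (bp j + i) j.+1 (B (bp j + i)) (T (tp j.+1))
    (iter i (@extend R) (flip (iter a (@extend R) (chain_stats j)))).
  elim: i => [|i IHi] ib.
    by rewrite addn0 tS; apply/network_flip/Ha.
  by rewrite addnS; apply: stage_extend_bot (IHi (ltnW ib)); lia.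
apply/network_flip/stage_close => //; last by rewrite bS; apply: Hb.
by rewrite !iter_extend /= !addr_ge0.
Qed.

Lemma Kf_chain : 2 * Kf R (chain k h w) = sK (chain_stats h).
Proof.
have [_ H] := stage_chain (leqnn h).
apply: (@Kf_network _ (chain k h w) (T (tp h)) (B (bp h))).
apply: network_eq H.
  by apply/setP => -[a|b]; rewrite !inE /= -ltnS ltn_ord.
have rungE a b : stage_rung h.+1 a b = rung k h w a b.
  apply/hasP/existsP => [[i]|[i ab]]; last by exists (i : nat); rewrite ?mem_iota /=.
  by rewrite mem_iota /= add0n => ih ab; exists (Ordinal ih).
move=> [a|a] [b|b] //=; rewrite ?rungE //; congr (_%:R); congr nat_of_bool.
  by rewrite -(ltnS a) -(ltnS b) !ltn_ord !andbT.
by rewrite -(ltnS a) -(ltnS b) !ltn_ord !andbT.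
Qed.

End ChainNetwork.

(** * Comparing two networks through one polygon *)

Section Comparison.
Variable R : realType.
Implicit Types (x y : stats R) (a b : nat).

(* In use, y belongs to the helicene, whose sum of D is nonpositive. *)
Record dominated x y : Prop := {
  dom_N : sN x = sN y;
  dom_r : sr x = sr y;
  dom_D : `|sD x| <= - sD y;
  dom_Q : sQ x <= sQ y;
  dom_var : sN x * sQ x - sD x ^+ 2 <= sN y * sQ y - sD y ^+ 2;
  dom_S : sS y <= sS x;
  dom_K : sK y <= sK x }.

Definition turn a b : R := b%:R - a%:R.

(* The part of the increment of sQ that depends on the turn e. *)
Definition gain x (e : R) := excess x * e ^+ 2 - 2 * e * sD x.

(** The difference of the gains is exactly the sum of the three nonnegative products [p1], [p2] and
    [p3]. *)
Lemma gain_le x y e e' : dominated x y -> 0 <= excess x -> `|e| <= e' ->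
  gain x e <= gain y e'.
Proof.
case: x y => N r D Q S K [N' r' D' Q' S' K'] [/= <- <- hD _ _ _ _].
rewrite /gain /excess /= => n0; move: hD; rewrite !ler_norml => /andP[h1 h2] /andP[h3 h4].
have p1 : 0 <= (N - 1 - r) * ((e' - e) * (e' + e)).
  by rewrite mulr_ge0 // mulr_ge0 //; lra.
have p2 : 0 <= (e' + e) * (D - D') by rewrite mulr_ge0 //; lra.
have p3 : 0 <= (e' - e) * (- D' - D) by rewrite mulr_ge0 //; lra.
by lra.
Qed.

Lemma dominated_step a b a' b' x y : (a + b = a' + b')%N ->
  0 <= sr x -> 0 <= excess x -> 0 <= sN x -> dominated x y ->
  `|turn a b| <= turn a' b' ->
  dominated (ring_step a b x) (ring_step a' b' y).
Proof.
move=> ab r0 n0 N0 xy ee; have := gain_le xy n0 ee.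
have r0' : 0 <= sr y by rewrite -(dom_r xy).
rewrite (ring_stepE _ _ r0) (ring_stepE _ _ r0') -ab /Qpre /gain -!/(turn _ _).
move: (turn a b) (turn a' b') ee => e e' ee {r0'}.
have m0 : 0 <= (a + b)%:R :> R by [].
move: ((a + b)%:R) m0 => m m0.
case: x y r0 n0 N0 xy => N r D Q S K [N' r' D' Q' S' K'] /= r0.
rewrite /excess /= => n0 N0 [/= <- <- hD hQ hV hS hK] hg.
have W0 : 0 < r + m + 1 by rewrite ltr_wpDl // addr_ge0.
have mQ : m * Q <= m * Q' by rewrite ler_wpM2l.
have mS : m * S' <= m * S by rewrite ler_wpM2l.
have i0 : 0 <= (r + m + 1)^-1 by rewrite invr_ge0 ltW.
have j0 : 0 <= (2 * (r + m + 1))^-1 by rewrite invr_ge0 mulr_ge0 // ltW.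
move: (cubic (r + m)) (cubic r) => c1 c2.
split=> //=.
- rewrite -[X in _ <= X]mulNr normrM (ger0_norm i0) ler_wpM2r //.
  apply: le_trans (ler_normB _ _) _; rewrite normrM (ger0_norm n0).
  have : (N - 1 - r) * `|e| <= (N - 1 - r) * e' by rewrite ler_wpM2l.
  by lra.
- apply: ler_wpM2r; [by rewrite invr_ge0 sqr_ge0 | by lra].
- rewrite !expr_div_n !mulrA -!mulrBl; apply: ler_wpM2r;
  first by rewrite invr_ge0 sqr_ge0.
  (* In (N + m) [Qpre] - (D - n e)^2 the turn occurs only as N + m - n = m + 1 + r times the gain.
     Up to a constant the rest is m Q + (N Q - D^2), bounded by [hQ] and [hV]. *)
  have : (m + 1 + r) * ((N - 1 - r) * e ^+ 2 - 2 * e * D) <=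
         (m + 1 + r) * ((N - 1 - r) * e' ^+ 2 - 2 * e' * D').
    by rewrite ler_wpM2l //; lra.
  by lra.
- by apply: lerB; [lra | apply: ler_wpM2r => //; lra].
- by apply: lerB; [lra | apply: ler_wpM2r => //; lra].
Qed.

(** Strictness is followed through [sS]: a strict gain creates it, later polygons preserve it, and
    [sK_step] passes it on to [sK]. *)
Lemma sS_step_lt a b a' b' x y : (a + b = a' + b')%N ->
  0 <= sr x -> dominated x y ->
  gain x (turn a b) <= gain y (turn a' b') ->
  sS y < sS x \/ gain x (turn a b) < gain y (turn a' b') ->
  sS (ring_step a' b' y) < sS (ring_step a b x).
Proof.
move=> ab r0 xy; have r0' : 0 <= sr y by rewrite -(dom_r xy).
rewrite (ring_stepE _ _ r0) (ring_stepE _ _ r0') -ab /Qpre /gain -!/(turn _ _).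
move: (turn a b) (turn a' b') => e e' {r0'}.
have m0 : 0 <= (a + b)%:R :> R by [].
move: ((a + b)%:R) m0 => m m0.
case: x y r0 xy => N r D Q S K [N' r' D' Q' S' K'] /= r0.
rewrite /excess /= => [[/= <- <- _ hQ _ hS _]] hg.
have W0 : 0 < r + m + 1 by rewrite ltr_wpDl // addr_ge0.
have j0 : 0 < (2 * (r + m + 1))^-1 by rewrite invr_gt0 mulr_gt0.
case=> h; first by rewrite ltr_leB ?ltrD2r // ler_pM2r //; lra.
by rewrite ler_ltB ?lerD2r // ltr_pM2r //; lra.
Qed.

Lemma sK_step a b a' b' x y : (a + b = a' + b')%N -> (0 < a + b)%N ->
  0 <= sr x -> 0 <= sN x -> dominated x y ->
  sK (ring_step a' b' y) <= sK (ring_step a b x) /\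
  (sS y < sS x -> sK (ring_step a' b' y) < sK (ring_step a b x)).
Proof.
move=> ab ab0 r0 N0 xy; have r0' : 0 <= sr y by rewrite -(dom_r xy).
have m0 : 0 < (a + b)%:R :> R by rewrite ltr0n.
rewrite (ring_stepE _ _ r0) (ring_stepE _ _ r0') -ab.
move: ((a + b)%:R) m0 => m m0 {r0'}.
case: x y r0 N0 xy => N r D Q S K [N' r' D' Q' S' K'] /= r0 N0.
case=> /= <- <- _ hQ hV hS hK.
have W0 : 0 < r + m + 1 by rewrite ltr_wpDl // addr_ge0 // ltW.
have mQ : m * Q <= m * Q' by rewrite ler_pM2l.
have j0 : 0 <= (2 * (r + m + 1))^-1 by rewrite invr_ge0 mulr_ge0 // ltW.
have V : ((N + m) * Q - D ^+ 2) / (2 * (r + m + 1)) <=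
         ((N + m) * Q' - D' ^+ 2) / (2 * (r + m + 1)).
  by rewrite ler_wpM2r //; lra.
split; last first.
  by move=> h; have : m * S' < m * S; [rewrite ltr_pM2l | lra].
by have : m * S' <= m * S; [rewrite ler_pM2l | lra].
Qed.

End Comparison.

(** * The helicene against an arbitrary chain *)

Section ChainComparison.
Variables (R : realType) (k h : nat).
Hypothesis hk : (5 <= k)%N.

(** Past the end of [w] the default 0 satisfies the bound, so i ranges over all naturals. *)
Definition insertions w := forall i, (nth 0%N w i <= k - 4)%N.

Lemma sub_sum w j : insertions w -> (top_sub k h w j + bot_sub k h w j = k - 4)%N.
Proof.
move=> hw; rewrite /top_sub /bot_sub; case: ifP => _; first by lia.
by rewrite subnKC.
Qed.

Lemma ring_size w j : insertions w ->
  ((top_sub k h w j).+1 + (bot_sub k h w j).+1 = k - 2)%N.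
Proof. by move/(sub_sum j); lia. Qed.

Lemma turnE w j : insertions w -> (0 < j)%N -> (j < h.-1)%N ->
  turn R (top_sub k h w j).+1 (bot_sub k h w j).+1 =
  (k - 4)%:R - 2 * (nth 0%N w j.-1)%:R.
Proof.
move=> hw j0 jh; have := sub_sum j hw.
rewrite /turn /top_sub; case: ifP => [|_]; first by lia.
by move=> <-; rewrite natrD -!natr1; ring.
Qed.

Lemma chain_size w j : insertions w ->
  [/\ 0 <= sr (chain_stats R k h w j), sr (chain_stats R k h w j) <= 1
    & sN (chain_stats R k h w j) = 2 + j%:R * (k - 2)%:R].
Proof.
move=> hw; elim: j => [|j [r0 r1 HN]].
  by rewrite /= add0r ler01 mul0r addr0.
rewrite chain_statsS ring_stepE //= ring_size //.
have W0 : 0 <= sr (chain_stats R k h w j) + (k - 2)%:R by rewrite addr_ge0.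
split; first by rewrite divr_ge0 // addr_ge0.
  by rewrite ler_pdivrMr ?ltr_wpDl // mul1r lerDl.
by rewrite HN -natr1; ring.
Qed.

(** The last rung joins the terminals, so r is at most 1, while one polygon already brings N above
    2. For the initial rung the excess is 2 - 1 - 1 = 0. *)
Lemma excess_gt0 w j : insertions w -> (0 < j)%N ->
  0 < excess (chain_stats R k h w j).
Proof.
case: j => // j hw _; have [_ r1 HN] := chain_size j.+1 hw.
have : 0 <= j%:R * (k - 2)%:R :> R by rewrite mulr_ge0.
have : 1 <= (k - 2)%:R :> R by rewrite ler1n; lia.
by rewrite /excess HN -natr1; lra.
Qed.

Lemma chain_stats1 w w' : chain_stats R k h w 1 = chain_stats R k h w' 1.
Proof. by []. Qed.

(** The initial rung has zero excess and zero [sD], so an uneven split of the first polygon, for odd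
    k, leaves no trace. *)
Lemma sD_chain1 w : sD (chain_stats R k h w 1) = 0.
Proof.
rewrite chain_statsS ring_stepE /=; last by rewrite add0r ler01.
rewrite /excess /=; set e := _%:R - _%:R.
by rewrite (_ : _ - _ * e = 0) ?mul0r //; ring.
Qed.

Let w0 := nseq (h - 2) 0%N.

Lemma insertions0 : insertions w0.
Proof. by move=> i; rewrite nth_nseq; case: ifP. Qed.

(** Every inner turn of the helicene is k - 4, the largest absolute value allowed. The last polygon
    is left to [sK_step]. *)
Lemma chain_dominated w j : insertions w -> (0 < j)%N -> (j < h)%N ->
  dominated (chain_stats R k h w j) (chain_stats R k h w0 j).
Proof.
move=> hw; elim: j => // -[_ _ _|j IH _ jh].
  by rewrite (chain_stats1 w w0); split; rewrite ?sD_chain1 ?normr0 ?oppr0.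
have h0 := insertions0; have [r0 _ HN] := chain_size j.+1 hw.
rewrite chain_statsS [in X in dominated _ X]chain_statsS.
apply: dominated_step; rewrite ?ring_size ?(ltW (excess_gt0 hw _)) //.
- by rewrite HN addr_ge0 // mulr_ge0.
- by apply: IH => //; apply: ltnW.
rewrite !turnE //; try by lia.
rewrite nth_nseq if_same mulr0 subr0 ler_norml.
have : (nth 0 w j.+1.-1)%:R <= (k - 4)%:R :> R by rewrite ler_nat.
have : 0 <= (nth 0 w j.+1.-1)%:R :> R by [].
by lra.
Qed.

Lemma sD_chainS w j : insertions w -> (0 < j)%N -> (j < h.-1)%N ->
  sD (chain_stats R k h w j.+1) =
  (sD (chain_stats R k h w j) - excess (chain_stats R k h w j)
     * ((k - 4)%:R - 2 * (nth 0%N w j.-1)%:R))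
  / (sr (chain_stats R k h w j) + (k - 2)%:R + 1).
Proof.
move=> hw j0 jh; have [r0 _ _] := chain_size j hw.
by rewrite chain_statsS ring_stepE // ring_size // -!/(turn _ _ _) turnE.
Qed.

Lemma sD_helicene j : (1 < j)%N -> (j < h)%N -> sD (chain_stats R k h w0 j) < 0.
Proof.
case: j => [|[|j]] // _ jh; have h0 := insertions0.
have jh' := ltnW jh.
have D0 := dom_D (chain_dominated h0 (ltn0Sn j) jh').
have {}D0 : sD (chain_stats R k h w0 j.+1) <= 0.
  by rewrite -oppr_ge0; apply: le_trans D0.
have [r0 _ _] := chain_size j.+1 h0.
have n0 := excess_gt0 h0 (ltn0Sn j).
rewrite sD_chainS //; last by lia.
rewrite nth_nseq if_same mulr0 subr0 pmulr_llt0.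
  have : 0 < excess (chain_stats R k h w0 j.+1) * (k - 4)%:R.
    by rewrite mulr_gt0 // ltr0n; lia.
  by lra.
by rewrite invr_gt0 ltr_wpDl // addr_ge0.
Qed.

(** As long as [sS] is not strict, all turns so far are extreme and of one sign. Knowing [sD]
    exactly in these two cases allows the next gain to be computed. *)
Lemma sS_chain_lt w j : insertions w -> (0 < j)%N -> (j < h)%N ->
  [\/ (forall i, (i < j.-1)%N -> nth 0%N w i = 0%N) /\
      sD (chain_stats R k h w j) = sD (chain_stats R k h w0 j),
      (forall i, (i < j.-1)%N -> nth 0%N w i = (k - 4)%N) /\
      sD (chain_stats R k h w j) = - sD (chain_stats R k h w0 j)
    | sS (chain_stats R k h w0 j) < sS (chain_stats R k h w j)].
Proof.
move=> hw; elim: j => // -[_ _ _|j IH _ jh].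
  by apply: Or31; rewrite !sD_chain1.
have h0 := insertions0; have {}jh : (j.+1 < h.-1)%N by lia.
have [r0 _ HN] := chain_size j.+1 hw; have [_ _ HN'] := chain_size j.+1 h0.
have dom := chain_dominated hw (ltn0Sn j) (leq_trans jh (leq_pred h)).
have n0 := excess_gt0 hw (ltn0Sn j).
have nE : excess (chain_stats R k h w j.+1) = excess (chain_stats R k h w0 j.+1).
  by rewrite /excess (dom_N dom) (dom_r dom).
have D0 : sD (chain_stats R k h w0 j.+1) <= 0.
  by rewrite -oppr_ge0; apply: le_trans (dom_D dom).
have wk : (nth 0 w j)%:R <= (k - 4)%:R :> R by rewrite ler_nat.
have wk0 : 0 <= (nth 0 w j)%:R :> R by [].
have d0 : 0 < (k - 4)%:R :> R by rewrite ltr0n; lia.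
have ee : `|turn R (top_sub k h w j.+1).+1 (bot_sub k h w j.+1).+1| <=
          turn R (top_sub k h w0 j.+1).+1 (bot_sub k h w0 j.+1).+1.
  by rewrite !turnE // nth_nseq if_same mulr0 subr0 ler_norml /=; lra.
have gle := gain_le dom (ltW n0) ee.
have strict : sS (chain_stats R k h w0 j.+1) < sS (chain_stats R k h w j.+1) \/
    gain (chain_stats R k h w j.+1) ((k - 4)%:R - 2 * (nth 0 w j)%:R) <
    gain (chain_stats R k h w0 j.+1) (k - 4)%:R ->
    sS (chain_stats R k h w0 j.+2) < sS (chain_stats R k h w j.+2).
  move=> H; rewrite chain_statsS [X in _ < sS X]chain_statsS.
  apply: sS_step_lt; rewrite ?ring_size //.
  by rewrite !turnE // nth_nseq if_same mulr0 subr0.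
(* At the first inner polygon [sD] is 0 and both signs are equally good; afterwards [sD] is nonzero
   and forces the sign. *)
have j1 : j = 0%N \/ sD (chain_stats R k h w0 j.+1) < 0.
  by case: (j) jh => [|i] ih; [left | right; apply: sD_helicene; lia].
have nthS (c : nat) : (forall i, (i < j)%N -> nth 0%N w i = c) -> nth 0%N w j = c ->
    forall i, (i < j.+1)%N -> nth 0%N w i = c.
  by move=> H wj i; rewrite ltnS leq_eqVlt => /orP[/eqP -> | /H].
have n'0 : 0 < excess (chain_stats R k h w0 j.+1) by rewrite -nE.
have nth0 : nth 0%N w0 j = 0%N by rewrite nth_nseq if_same.
have sD0 := sD_chainS h0 (ltn0Sn j) jh; have sDw := sD_chainS hw (ltn0Sn j) jh.
rewrite nE (dom_r dom) in sDw; rewrite [_.-1]/= nth0 mulr0 subr0 in sD0.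
rewrite [_.-1]/= in sDw; rewrite /gain nE in strict.
(* With c = k - 4, the squares of the turns differ by c^2 - (c - 2 x)^2 = 4 x (c - x). The linear
   parts of the gains add -4 D x if the earlier turns agree with the helicene, and -4 D (c - x) if
   they are opposite, where D is the helicene's [sD]. *)
have q0 : 0 <= excess (chain_stats R k h w0 j.+1) *
    ((nth 0 w j)%:R * ((k - 4)%:R - (nth 0 w j)%:R)).
  by apply: mulr_ge0; [exact: ltW | rewrite mulr_ge0 // subr_ge0].
have q1 : (0 < nth 0 w j)%N -> (nth 0 w j != k - 4)%N ->
    0 < excess (chain_stats R k h w0 j.+1) *
    ((nth 0 w j)%:R * ((k - 4)%:R - (nth 0 w j)%:R)).
  move=> x0 xk; rewrite mulr_gt0 // mulr_gt0 ?ltr0n // subr_gt0 ltr_nat.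
  by rewrite ltn_neqAle xk hw.
have jh' : (j.+1 < h)%N := leq_trans jh (leq_pred h).
case: (IH isT jh') => [[wi E]|[wi E]|H].
- have [x0|x0] := posnP (nth 0%N w j).
    by apply: Or31; split; [exact: nthS | rewrite sDw E x0 mulr0 subr0].
  case: j1 => [j0|Dlt].
    have [xk|xk] := eqVneq (nth 0%N w j) (k - 4)%N.
      (* There are no earlier entries here, so the chain may still join the mirror family. *)
      apply: Or32; split; first by apply: nthS => // i; rewrite j0.
      by rewrite sDw sD0 xk j0 !sD_chain1 -[RHS]mulNr; congr (_ / _); ring.
    apply: Or33; apply: strict; right; have := q1 x0 xk.
    by rewrite j0 !sD_chain1; lra.
  apply: Or33; apply: strict; right; rewrite E.
  have : 0 < - sD (chain_stats R k h w0 j.+1) * (nth 0 w j)%:R.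
    by rewrite mulr_gt0 ?ltr0n // oppr_gt0.
  by lra.
- have [xk|xk] := eqVneq (nth 0%N w j) (k - 4)%N.
    apply: Or32; split; first exact: nthS.
    by rewrite sDw sD0 E xk -[RHS]mulNr; congr (_ / _); ring.
  case: j1 => [j0|Dlt].
    have [x0|x0] := posnP (nth 0%N w j).
      apply: Or31; split; first by apply: nthS => // i; rewrite j0.
      by rewrite sDw sD0 x0 j0 !sD_chain1 mulr0 subr0.
    apply: Or33; apply: strict; right; have := q1 x0 xk.
    by rewrite j0 !sD_chain1; lra.
  apply: Or33; apply: strict; right; rewrite E.
  have : 0 < - sD (chain_stats R k h w0 j.+1) * ((k - 4)%:R - (nth 0 w j)%:R).
    by rewrite mulr_gt0 ?oppr_gt0 // subr_gt0 ltr_nat ltn_neqAle xk hw.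
  by lra.
- by apply: Or33; apply: strict; left.
Qed.

Hypothesis hh : (2 <= h)%N.

(** The last turn does not enter [sK], so equality is decided by [sS] after h - 1 polygons, where
    the inner entries are exactly the first h - 2. *)
Lemma Kf_helicene_le w : insertions w ->
  Kf R (helicene k h) <= Kf R (chain k h w) /\
  (Kf R (chain k h w) = Kf R (helicene k h) ->
    (forall i, (i < h - 2)%N -> nth 0%N w i = 0%N) \/
    (forall i, (i < h - 2)%N -> nth 0%N w i = (k - 4)%N)).
Proof.
move=> hw; have h1 : (0 < h.-1)%N by lia.
have h2 : (h.-1 < h)%N by lia.
have [r0 _ HN] := chain_size h.-1 hw.
have N0 : 0 <= sN (chain_stats R k h w h.-1) by rewrite HN addr_ge0 // mulr_ge0.
have h0 := insertions0; have dom := chain_dominated hw h1 h2.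
have sz := etrans (ring_size h.-1 hw) (esym (ring_size h.-1 h0)).
have sz0 : (0 < (top_sub k h w h.-1).+1 + (bot_sub k h w h.-1).+1)%N by [].
have [] := sK_step sz sz0 r0 N0 dom; rewrite -!chain_statsS (ltn_predK h2).
rewrite -!Kf_chain => le lt; split; first by rewrite -(ler_pM2l (ltr0Sn R 1)).
move=> E; have {le lt} nS : ~~ (sS (chain_stats R k h w0 h.-1) < sS (chain_stats R k h w h.-1)).
  by apply/negP => /lt; rewrite E ltxx.
have hE : (h - 2 = h.-1.-1)%N by lia.
rewrite !hE; case: (sS_chain_lt hw h1 h2) => [[H _]|[H _]|H]; [by left|by right|].
by rewrite H in nS.
Qed.

End ChainComparison.

(** * Turning a chain over *)

Section Flip.
Variables (k h : nat).
Hypothesis hh : (2 <= h)%N.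

Definition flipped w w' := forall i, (0 < i)%N -> (i < h.-1)%N ->
  top_sub k h w i = bot_sub k h w' i /\ bot_sub k h w i = top_sub k h w' i.

Lemma flipped_sym w w' : flipped w w' -> flipped w' w.
Proof. by move=> H i i0 ih; have [-> ->] := H i i0 ih. Qed.

(** The parity of k: how many more insertions an end polygon has on top than at the bottom. *)
Let dl := (uphalf (k - 4) - (k - 4)./2)%N.

Lemma top_posS w j : top_pos k h w j.+1 = (top_pos k h w j + (top_sub k h w j).+1)%N.
Proof. by rewrite /top_pos big_nat_recr. Qed.

Lemma bot_posS w j : bot_pos k h w j.+1 = (bot_pos k h w j + (bot_sub k h w j).+1)%N.
Proof. by rewrite /bot_pos big_nat_recr. Qed.

Lemma top_pos0 w : top_pos k h w 0 = 0%N. Proof. exact: big_geq. Qed.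
Lemma bot_pos0 w : bot_pos k h w 0 = 0%N. Proof. exact: big_geq. Qed.

(** Inner polygons exchange top and bottom exactly, so the first polygon alone causes the offset;
    the last one adds it a second time in [flipped_pos_end]. *)
Lemma flipped_pos w w' j : flipped w w' -> (0 < j)%N -> (j < h)%N ->
  top_pos k h w j = (bot_pos k h w' j + dl)%N.
Proof.
move=> H; elim: j => // -[_ _ _|j IH _ jh].
  by rewrite top_posS bot_posS top_pos0 bot_pos0 /top_sub /bot_sub /= /dl; lia.
have [|E _] := H j.+1 isT; first by lia.
by rewrite top_posS bot_posS IH // ?(ltnW jh) // E; lia.
Qed.

Lemma flipped_pos_end w w' : flipped w w' ->
  top_pos k h w h = (bot_pos k h w' h + dl + dl)%N.
Proof.
move=> H; have hE : h = h.-1.+1 by lia.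
rewrite [X in top_pos _ _ _ X]hE [X in bot_pos _ _ _ X]hE top_posS bot_posS.
rewrite (flipped_pos H) ?prednK //; try by lia.
by rewrite /top_sub /bot_sub eqxx orbT /dl; lia.
Qed.

(* Turning the chain over exchanges the two paths, but when k is odd the end
   polygons have one more vertex on top, so all vertices also move one step along
   the outer cycle and the two ends of the top path stay on top. *)
Definition turn_over w w' (x : chain_vertex k h w) : chain_vertex k h w' :=
  match x with
  | inl a => if (a < dl)%N then inl ord0
             else if (top_pos k h w h < a + dl)%N then inl ord_max
             else inr (inord (a - dl))
  | inr b => inl (inord (b + dl))
  end.

Lemma turn_over_low w w' (a : 'I_(top_pos k h w h).+1) : (a < dl)%N ->
  turn_over w' (inl a : chain_vertex k h w) = inl ord0.
Proof. by move=> /= ->. Qed.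

Lemma turn_over_high w w' (a : 'I_(top_pos k h w h).+1) :
  (dl <= a)%N -> (top_pos k h w h < a + dl)%N ->
  turn_over w' (inl a : chain_vertex k h w) = inl ord_max.
Proof. by move=> /= H ->; rewrite ltnNge H. Qed.

Lemma turn_over_mid w w' (a : 'I_(top_pos k h w h).+1) :
  (dl <= a)%N -> (a + dl <= top_pos k h w h)%N ->
  turn_over w' (inl a : chain_vertex k h w) = inr (inord (a - dl)).
Proof. by move=> /= H1 H2; rewrite !ltnNge H1 H2. Qed.

Lemma turn_overK w w' : flipped w w' -> cancel (@turn_over w w') (@turn_over w' w).
Proof.
move=> H; have H' := flipped_sym H.
have E := flipped_pos_end H; have E' := flipped_pos_end H'.
have dl1 : (dl <= 1)%N by rewrite /dl; lia.
move=> [a|b] /=; last first.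
  have bh := ltn_ord b; rewrite inordK; last by lia.
  rewrite ifN ?ifN; [|by lia|by lia].
  by rewrite addnK inord_val.
have ah := ltn_ord a.
case: ifP => a0 /=; first by rewrite ifT; [congr inl; apply: val_inj => /=; lia | lia].
case: ifP => a1 /=.
  rewrite ifN ?ifT; [|by lia|by lia].
  by congr inl; apply: val_inj => /=; lia.
rewrite inordK; last by lia.
by congr inl; apply: val_inj; rewrite /= inordK; lia.
Qed.

Lemma turn_over_adj w w' x y : flipped w w' ->
  chain_adj x y -> chain_adj (@turn_over w w' x) (@turn_over w w' y).
Proof.
move=> H; have H' := flipped_sym H.
have E := flipped_pos_end H; have E' := flipped_pos_end H'.
have dl1 : (dl <= 1)%N by rewrite /dl; lia.
have rungI j (a b : nat) : (j <= h)%N -> a = top_pos k h w' j -> b = bot_pos k h w' j ->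
    rung k h w' a b.
  by move=> jh -> ->; apply/existsP; exists (inord j); rewrite inordK // !eqxx.
have top_step (a b : 'I_(top_pos k h w h).+1) : a.+1 = b ->
    chain_adj (@turn_over w w' (inl a)) (@turn_over w w' (inl b)).
  move=> ab; have ah := ltn_ord a; have bh := ltn_ord b.
  (* When [dl] is 1, an end rung and the outermost top edge beside it trade places. *)
  have [a0|a0] := ltnP a dl.
    rewrite turn_over_low // turn_over_mid; [|by lia|by lia].
    by apply: (rungI 0%N); rewrite ?top_pos0 ?bot_pos0 // inordK; lia.
  have [b1|b1] := ltnP (top_pos k h w h) (b + dl); last first.
    by rewrite !turn_over_mid /= ?inordK; lia.
  rewrite turn_over_mid ?turn_over_high; try by lia.
  by apply: (rungI h); rewrite // ?inordK; lia.
have rung_step (a : 'I_(top_pos k h w h).+1) (b : 'I_(bot_pos k h w h).+1) :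
    rung k h w a b ->
    chain_adj (@turn_over w w' (inl a)) (@turn_over w w' (inr b)).
  move=> /existsP[[j jh] ab]; have [/eqP aj /eqP bj] := andP ab.
  rewrite /= in aj bj => {ab}.
  have := ltn_ord a; have := ltn_ord b; move=> bh ah.
  have [j0|j0] := posnP j.
    rewrite j0 top_pos0 in aj; rewrite j0 bot_pos0 in bj.
    have [d0|d0] := ltnP a dl.
      by rewrite turn_over_low //= inordK; lia.
    rewrite turn_over_mid; [|by lia|by lia].
    by apply: (rungI 0%N); rewrite ?top_pos0 ?bot_pos0 // inordK; lia.
  have [jE|jE] := eqVneq j h.
    rewrite jE in aj bj.
    have [d0|d0] := ltnP (top_pos k h w h) (a + dl).
      by rewrite turn_over_high /= ?inordK; lia.
    rewrite turn_over_mid; [|by lia|by lia].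
    by apply: (rungI h); rewrite // inordK; lia.
  have jlt : (j < h)%N by lia.
  have F := flipped_pos H j0 jlt; have F' := flipped_pos H' j0 jlt.
  have := top_pos_lt k h w' jlt; have := bot_pos_lt k h w' jlt.
  have := top_pos_lt k h w' j0; have := bot_pos_lt k h w' j0.
  rewrite top_pos0 bot_pos0 => *.
  rewrite turn_over_mid; [|by lia|by lia].
  by apply: (rungI j); rewrite ?inordK; lia.
case: x y => [a|b] [a'|b'].
- case/orP => /eqP; first by move=> aa; apply: (top_step a a' aa).
  by rewrite chain_adj_sym => aa; apply: (top_step _ _ aa).
- exact: rung_step.
- by move=> r; rewrite chain_adj_sym; apply: rung_step.
- move=> /= adj; have := ltn_ord b; have := ltn_ord b' => ? ?.
  by rewrite !inordK; lia.
Qed.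

Lemma flipped_isomorphic w w' : flipped w w' ->
  isomorphic (chain k h w) (chain k h w').
Proof.
move=> H; have H' := flipped_sym H.
exists (@turn_over w w'); split.
  by exists (@turn_over w' w); apply: turn_overK.
move=> x y; apply/idP/idP; last exact: turn_over_adj.
by move/(turn_over_adj H'); rewrite !turn_overK.
Qed.

End Flip.

Lemma isomorphic_trans G H K : isomorphic G H -> isomorphic H K -> isomorphic G K.
Proof.
move=> [f [fb fa]] [g [gb ga]]; exists (g \o f); split; first exact: bij_comp.
by move=> x y; rewrite /= ga fa.
Qed.

Theorem theorem1p1 (R : realType) (k h : nat) (hk : (5 <= k)%N) (hh : (2 <= h)%N)
    (G : cgraph) (hG : is_chain k h G) :
  Kf R (helicene k h) <= Kf R G /\
  (Kf R G = Kf R (helicene k h) <-> isomorphic G (helicene k h)).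
Proof.
have [w [wk Gw]] := hG; rewrite (Kf_isomorphic R Gw).
have hw : insertions k w.
  move=> i; have [iw|wi] := ltnP i (size w); last by rewrite nth_default.
  by move: (iw); rewrite size_tuple => ih; rewrite -(tnth_nth _ _ (Ordinal ih)).
have [le eq] := Kf_helicene_le R hk hh hw; split=> //; split; last first.
  by move=> /(Kf_isomorphic R) <-; rewrite (Kf_isomorphic R Gw).
move=> /eq[] wE; apply: isomorphic_trans Gw _.
  rewrite /helicene (_ : nseq (h - 2) 0%N = w :> seq nat); last first.
    apply: (@eq_from_nth _ 0%N); rewrite size_nseq ?size_tuple // => i ih.
    by rewrite wE // nth_nseq ih.
  by exists id; split=> //; exists id.
(* Turning over replaces each entry x by k - 4 - x, so the constant word k - 4 becomes the constant
   word 0. *)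
apply: flipped_isomorphic => // i i0 ih.
rewrite /top_sub /bot_sub.
have -> : (i == 0%N) || (i == h.-1) = false by lia.
by rewrite wE ?nth_nseq ?if_same ?subnn ?subn0 //; lia.
Qed.
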